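(* The edge-insertion operation $\triangleleft$ on the vector space $k\{\mathcal{T}\}$ spanned by nonplanar rooted binary trees is a (right) pre-Lie operation; that is, for all $x,y,z\in k\{\mathcal{T}\}$, $$(x\triangleleft y)\triangleleft z-x\triangleleft(y\triangleleft z)=(x\triangleleft z)\triangleleft y-x\triangleleft(z\triangleleft y).$$
   Context: A (nonplanar rooted) binary tree is a finite rooted tree, without a planar embedding, in which every vertex has either $0$ or $2$ children; vertices with $0$ children are the leaves (the single-vertex tree is allowed). Leaves may carry labels from a fixed set, and isomorphisms of trees preserve roots and labels. Let $k$ be a field of characteristic $0$, $\mathcal{T}$ the set of isomorphism classes of binary trees, and $k\{\mathcal{T}\}$ the $k$-vector space with basis $\mathcal{T}$. For trees $T,S$ and an edge $e$ of $T$, $T\triangleleft_e S$ is the tree obtained by splitting the edge $e$ by a new vertex and joining the root of $S$ to this new vertex by a new edge (so that the two children of the new vertex are the lower endpoint of $e$ and the root of $S$). Let $\mathfrak{M}(T,S)$ be the tree obtained by grafting $T$ and $S$ to a common new root, i.e. whose root has the two child subtrees $T$ and $S$. Define $$T\triangleleft S=\mathfrak{M}(T,S)+\sum_{e\in E(T)}T\triangleleft_e S$$ and extend $\triangleleft$ bilinearly to $k\{\mathcal{T}\}$. *)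

(* Defs.v *)
From HB Require Import structures.
From mathcomp Require Import all_boot all_order all_algebra.
From mathcomp Require Import freeg.

Set Implicit Arguments.
Unset Strict Implicit.
Unset Printing Implicit Defensive.

Import GRing.Theory.

Local Open Scope ring_scope.
Local Open Scope quotient_scope.

(* Planar representatives; nonplanar trees are their isomorphism classes.     *)
Inductive btree (L : Type) : Type :=
| Leaf of L
| Node of btree L & btree L.

Arguments Leaf {L} a.
Arguments Node {L} l r.

Section BinaryTreeChoice.
Variable L : Type.

Fixpoint btree_encode (t : btree L) : GenTree.tree L :=
  match t with
  | Leaf a => GenTree.Leaf a
  | Node l r => GenTree.Node 0 [:: btree_encode l; btree_encode r]
  end.

Fixpoint btree_decode (g : GenTree.tree L) : option (btree L) :=
  match g with
  | GenTree.Leaf a => Some (Leaf a)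
  | GenTree.Node _ [:: g1; g2] =>
      if btree_decode g1 is Some l then
        if btree_decode g2 is Some r then Some (Node l r) else None
      else None
  | _ => None
  end.

Lemma btree_encodeK : pcancel btree_encode btree_decode.
Proof. by elim=> //= l -> r ->. Qed.

End BinaryTreeChoice.

HB.instance Definition _ (L : choiceType) :=
  Choice.copy (btree L) (pcan_type (@btree_encodeK L)).

(* A vertex is the sequence of left (false) / right (true) turns leading to   *)
(* it from the root [::].                                                     *)
Definition vertex := seq bool.

Definition parent (v : vertex) : vertex := take (size v).-1 v.

Fixpoint vertices {L : Type} (t : btree L) : seq vertex :=
  match t with
  | Leaf _ => [:: [::]]
  | Node l r =>
      [::] :: [seq false :: v | v <- vertices l] ++
              [seq true :: v | v <- vertices r]
  end.

(* An edge is encoded by its lower endpoint.                                  *)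
Definition edges {L : Type} (t : btree L) : seq vertex :=
  [seq v <- vertices t | v != [::]].

Fixpoint leaf_label {L : Type} (t : btree L) (v : vertex) : option L :=
  match t, v with
  | Leaf a, [::] => Some a
  | Node l r, b :: v' => leaf_label (if b then r else l) v'
  | _, _ => None
  end.

Definition isomorphic (L : eqType) (t t' : btree L) : Prop :=
  exists f : vertex -> vertex,
    [/\ perm_eq [seq f v | v <- vertices t] (vertices t'),
        f [::] = [::],
        {in vertices t, {morph f : v / parent v}}
      & {in vertices t, forall v, leaf_label t' (f v) = leaf_label t v}].

Fixpoint btree_iso {L : eqType} (t t' : btree L) : bool :=
  match t, t' with
  | Leaf a, Leaf a' => a == a'
  | Node l r, Node l' r' =>
      btree_iso l l' && btree_iso r r' || btree_iso l r' && btree_iso r l'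
  | _, _ => false
  end.

Section IsomorphismTheory.
Variable L : eqType.
Implicit Types (t s l r : btree L) (v : vertex).

Lemma btree_iso_refl : reflexive (@btree_iso L).
Proof. by elim=> [a|l IHl r IHr] /=; rewrite ?eqxx ?IHl ?IHr. Qed.

Lemma btree_iso_sym : symmetric (@btree_iso L).
Proof.
elim=> [a|l IHl r IHr] [a'|l' r'] //=.
by rewrite !(IHl, IHr); congr orb; rewrite andbC.
Qed.

Lemma btree_iso_trans : transitive (@btree_iso L).
Proof.
elim=> [b|l IHl r IHr] [a|l1 r1] [c|l2 r2] //=; first by move=> /eqP->.
case/orP=> /andP[h1 h2] /orP[] /andP[h3 h4].
- by rewrite (IHl _ _ h1 h3) (IHr _ _ h2 h4).
- by rewrite (IHl _ _ h1 h3) (IHr _ _ h2 h4) orbT.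
- by rewrite (IHr _ _ h1 h4) (IHl _ _ h2 h3) orbT.
- by rewrite (IHr _ _ h1 h4) (IHl _ _ h2 h3).
Qed.

Lemma root_vertices t : [::] \in vertices t.
Proof. by case: t => *; rewrite inE. Qed.

Lemma mem_vertices_Node l r b v :
  (b :: v \in vertices (Node l r)) = (v \in vertices (if b then r else l)).
Proof.
rewrite /= inE /= mem_cat.
have inj c : injective (cons c : vertex -> vertex) by move=> ? ? [].
have nin c w (s : seq vertex) : (c :: w \in map (cons (~~ c)) s) = false.
  by apply/negbTE/mapP => -[u _ []] /eqP; case: c.
by case: b; rewrite (mem_map (@inj _)) ?(nin true) ?(nin false) ?orbF.
Qed.

Lemma uniq_vertices t : uniq (vertices t).
Proof.
elim: t => //= l IHl r IHr; rewrite cat_uniq !map_inj_uniq ?IHl ?IHr;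
  try by move=> ? ? [].
rewrite mem_cat /= andbT; apply/andP; split.
  by apply/negP=> /orP[] /mapP[].
by apply/hasPn=> ? /mapP[u _ ->]; apply/mapP => -[].
Qed.

Lemma parent_rcons v b : parent (rcons v b) = v.
Proof. by rewrite /parent size_rcons /= -cats1 take_size_cat. Qed.

Lemma parent_cons b v : parent (b :: v) = if v is [::] then [::] else b :: parent v.
Proof. by case: v. Qed.

Lemma vertices_parent t v : v \in vertices t -> parent v \in vertices t.
Proof.
elim: t v => [a|l IHl r IHr] [|b v] //.
rewrite mem_vertices_Node parent_cons; case: v => // c v vt.
rewrite mem_vertices_Node; case: b vt; [exact: IHr | exact: IHl].
Qed.

Lemma vertices_inj t t' f :
    perm_eq [seq f v | v <- vertices t] (vertices t') ->
  {in vertices t &, injective f}.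
Proof.
move=> pf v w vt wt e.
have Uf : uniq (map f (vertices t)) by rewrite (perm_uniq pf) uniq_vertices.
rewrite -(nth_index [::] vt) -(nth_index [::] wt); congr nth.
apply/eqP; rewrite -(nth_uniq [::] _ _ Uf) ?size_map ?index_mem //.
by rewrite !(nth_map [::]) ?index_mem // !nth_index // e.
Qed.

Lemma isomorphic_Node l r l' r' c :
    isomorphic l (if c then r' else l') -> isomorphic r (if c then l' else r') ->
  isomorphic (Node l r) (Node l' r').
Proof.
move=> [f [pf f0 mf lf]] [g [pg g0 mg lg]].
pose h v := if v is b :: v' then c (+) b :: (if b then g v' else f v') else [::].
exists h; split=> //.
- rewrite /= map_cat -!map_comp perm_cons.
  have -> : map (h \o cons false) (vertices l) = map (cons c) (map f (vertices l)).
    by rewrite -map_comp; apply: eq_map => v; rewrite /= addbF.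
  have -> : map (h \o cons true) (vertices r) = map (cons (~~ c)) (map g (vertices r)).
    by rewrite -map_comp; apply: eq_map => v; rewrite /= addbT.
  have {}pf := perm_map (cons c) pf.
  have {}pg := perm_map (cons (~~ c)) pg.
  apply: perm_trans (perm_cat pf pg) _.
  by case: c {h mf lf mg lg pf pg} => //=; rewrite perm_catC.
- move=> [|b v] //; rewrite mem_vertices_Node => vt.
  rewrite [in RHS]/h parent_cons.
  case: b vt => vt; rewrite parent_cons; case: v vt => [|b v] vt.
  + by rewrite g0.
  + have E : g (b :: v) <> [::].
      move=> E.
      have := vertices_inj pg vt (root_vertices _).
      by rewrite E g0 => /(_ erefl).
    by rewrite /h mg //; case: (g _) E.
  + by rewrite f0.
  + have E : f (b :: v) <> [::].
      move=> E; have := vertices_inj pf vt (root_vertices _).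
      by rewrite E f0 => /(_ erefl).
    by rewrite /h mf //; case: (f _) E.
- move=> [|b v] //; rewrite mem_vertices_Node /h.
  case: b => vt; rewrite [in RHS]/= -(lf,lg) //= -?lf ?lg //;
  by case: c {pf pg mf mg h} lf lg => lf lg /=; rewrite ?lf ?lg.
Qed.

Lemma isomorphic_NodeI l r l' r' : isomorphic (Node l r) (Node l' r') ->
  exists c : bool, isomorphic l (if c then r' else l') /\
                   isomorphic r (if c then l' else r').
Proof.
case=> f [pf f0 mf lf].
have inj_f := vertices_inj pf.
have fneq0 b v : b :: v \in vertices (Node l r) -> f (b :: v) <> [::].
  move=> vt; rewrite -f0 => /(inj_f _ _ vt (root_vertices _)).
  by [].
have top b : [:: b] \in vertices (Node l r).
  by rewrite mem_vertices_Node root_vertices.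
pose c b := head false (f [:: b]).
have fc b : f [:: b] = [:: c b].
  have := mf _ (top b); rewrite /= f0 /c.
  by case: (f [:: b]) (fneq0 _ _ (top b)) => // x [].
pose g b v := behead (f (b :: v)).
have fg b v : v \in vertices (if b then r else l) -> f (b :: v) = c b :: g b v.
  rewrite -(mem_vertices_Node l r) /g.
  elim/last_ind: v => [|v x IHv] vt; first by rewrite fc.
  have := mf _ vt; rewrite -rcons_cons parent_rcons IHv; last first.
    by have := vertices_parent vt; rewrite -rcons_cons parent_rcons.
  case: (f (b :: rcons v x)) => [|y w] //; rewrite parent_cons.
  by case: w => // ? ? [-> _].
have c_inj b b' : c b = c b' -> b = b'.
  by move=> e; have := inj_f _ _ (top b) (top b'); rewrite !fc e => /(_ erefl) [].
have sub b : isomorphic (if b then r else l) (if c b then r' else l').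
  exists (g b); split.
  - apply: uniq_perm; last 1 first.
    + move=> w; rewrite -mem_vertices_Node -(perm_mem pf).
      apply/mapP/mapP => [[v vt ->]|[[|b' v] vt]].
      * by exists (b :: v); rewrite ?mem_vertices_Node ?fg.
      * by rewrite f0.
      * move: vt; rewrite mem_vertices_Node => vt.
        by rewrite fg // => -[/c_inj eb ->]; exists v; rewrite eb.
    + rewrite map_inj_in_uniq ?uniq_vertices // => v w vt wt e.
      by have := inj_f (b :: v) (b :: w);
         rewrite !mem_vertices_Node !fg // e => /(_ vt wt erefl) [].
    + exact: uniq_vertices.
  - by rewrite /g fc.
  - move=> v vt; case: v vt => [|x v] vt; first by rewrite /g fc.
    have pt := vertices_parent vt.
    have := mf (b :: x :: v); rewrite mem_vertices_Node fg // => /(_ vt).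
    rewrite [parent (b :: _)]parent_cons fg // parent_cons.
    by case: (g b (x :: v)) => [|? ?] // [].
  - move=> v vt; have := lf (b :: v); rewrite mem_vertices_Node fg // => /(_ vt).
    by [].
exists (c false); split; first exact: (sub false).
have := sub true; have : c true = ~~ c false.
  by case e: (c true); case e': (c false) => //; have := c_inj true false;
     rewrite e e' => /(_ erefl).
by move=> ->; case: (c false).
Qed.

Lemma isomorphicP t t' : reflect (isomorphic t t') (btree_iso t t').
Proof.
apply: (iffP idP).
  elim: t t' => [a|l IHl r IHr] [a'|l' r'] //=.
    by move/eqP->; exists id; split=> // v; rewrite inE => /eqP->.
  case/orP=> /andP[/IHl hl /IHr hr].
    exact: (@isomorphic_Node _ _ _ _ false).
  exact: (@isomorphic_Node _ _ _ _ true).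
elim: t t' => [a|l IHl r IHr] [a'|l' r'] /=.
- case=> f [_ f0 _ /(_ [::])]; rewrite inE eqxx f0 => /(_ isT) [->]; exact: eqxx.
- case=> f [/perm_size /=]; rewrite size_cat !size_map.
  by have := root_vertices l'; case: (vertices l').
- case=> f [/perm_size /=]; rewrite size_map size_cat !size_map.
  by have := root_vertices l; case: (vertices l).
- case/isomorphic_NodeI=> -[] [/IHl-> /IHr->] //; exact: orbT.
Qed.

End IsomorphismTheory.

Canonical btree_iso_equiv (L : choiceType) :=
  EquivRel (@btree_iso L) (@btree_iso_refl L) (@btree_iso_sym L)
    (@btree_iso_trans L).

(* Isomorphism classes of binary trees with leaves labelled by L; unlabelled  *)
(* trees are the case L := unit.                                              *)
Definition nbtree (L : choiceType) := {eq_quot @btree_iso L}.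

HB.instance Definition _ (L : choiceType) := Choice.on (nbtree L).
HB.instance Definition _ (L : choiceType) := Quotient.on (nbtree L).
HB.instance Definition _ (L : choiceType) : EqQuotient _ (@btree_iso L) (nbtree L) :=
  EqQuotient.on (nbtree L).

(* At e = [::], which is not an edge, this would graft t and s to a common    *)
(* new root.                                                                  *)
Fixpoint insert_at {L : Type} (t : btree L) (e : vertex) (s : btree L) : btree L :=
  match e, t with
  | [::], _ => Node t s
  | false :: e', Node l r => Node (insert_at l e' s) r
  | true :: e', Node l r => Node l (insert_at r e' s)
  | _ :: _, Leaf a => Leaf a
  end.

Section EdgeInsertion.
Variables (L : choiceType) (k : fieldType).
Implicit Types T S : nbtree L.

(* The class of the grafting and the sum over the edges of T do not depend on *)
(* the planar representatives.                                                *)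
Definition graft T S : nbtree L :=
  \pi_(nbtree L) (Node (repr T) (repr S)).

Definition insert T (e : vertex) S : nbtree L :=
  \pi_(nbtree L) (insert_at (repr T) e (repr S)).

Definition edge_insertion_basis T S : {freeg (nbtree L) / k} :=
  << graft T S >> +
  \sum_(e <- edges (repr T)) << insert T e S >>.

Definition edge_insertion (x y : {freeg (nbtree L) / k}) : {freeg (nbtree L) / k} :=
  fglift (fun T => fglift (edge_insertion_basis T) y) x.

End EdgeInsertion.

Notation "x ◁ y" := (edge_insertion x y)
  (at level 40, left associativity) : ring_scope.

(* Main.v *)
(** Adding grafting to a common root to the sum over edges amounts to letting
    [e] run over all vertices of [T], an edge being named by its lower endpoint.
    With this convention the identity already holds for planar trees, by
    induction on [x]: subtracting [x ◁ (y ◁ z)] from [(x ◁ y) ◁ z] leaves the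
    insertions of [z] at places that do not belong to the inserted copy of [y],
    and this part is symmetric in [y] and [z]. *)

From HB Require Import structures.
Require Import Defs.
From mathcomp Require Import all_boot all_order all_algebra.
From mathcomp Require Import freeg.

Local Open Scope ring_scope.

Section PlanarInsertion.
Set Implicit Arguments.
Unset Strict Implicit.
Import GRing.Theory.

Lemma vertices_edges (L : Type) (t : btree L) : vertices t = [::] :: edges t.
Proof.
case: t => [a|l r] //; rewrite /edges /=; congr cons; symmetry.
by apply/all_filterP; rewrite all_cat !all_map; apply/andP; split; apply/allP.
Qed.

(* Insertion is encoded by its effect on test functions [phi], which makes it
   available both for planar trees and for their isomorphism classes. *)
Definition insertion_sum (L : Type) (M : nmodType) (t s : btree L)
    (phi : btree L -> M) : M :=
  \sum_(v <- vertices t) phi (insert_at t v s).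

Lemma insertion_sum_Leaf (L : Type) (M : nmodType) (a : L) s
    (phi : btree L -> M) :
  insertion_sum (Leaf a) s phi = phi (Node (Leaf a) s).
Proof. by rewrite /insertion_sum big_seq1. Qed.

Lemma insertion_sum_Node (L : Type) (M : nmodType) (l r s : btree L)
    (phi : btree L -> M) :
  insertion_sum (Node l r) s phi = phi (Node (Node l r) s)
    + (insertion_sum l s (fun x => phi (Node x r))
       + insertion_sum r s (fun x => phi (Node l x))).
Proof. by rewrite /insertion_sum /= big_cons big_cat /= !big_map. Qed.

Lemma eq_insertion_sum (L : Type) (M : nmodType) (t s : btree L)
    (phi psi : btree L -> M) :
  phi =1 psi -> insertion_sum t s phi = insertion_sum t s psi.
Proof. by move=> e; apply: eq_bigr => v _; apply: e. Qed.

Lemma insertion_sumD (L : Type) (M : nmodType) (t s : btree L)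
    (phi psi : btree L -> M) :
  insertion_sum t s (fun x => phi x + psi x)
    = insertion_sum t s phi + insertion_sum t s psi.
Proof. exact: big_split. Qed.

Lemma exchange_insertion_sum (L : Type) (M : nmodType) (t s t' s' : btree L)
    (phi : btree L -> btree L -> M) :
  insertion_sum t s (fun x => insertion_sum t' s' (phi x))
    = insertion_sum t' s' (fun y => insertion_sum t s (phi^~ y)).
Proof. exact: exchange_big. Qed.

Lemma insertion_sum_pre_lie (L : Type) (M : zmodType) (t s u : btree L)
    (phi : btree L -> M) :
  insertion_sum t s (fun x => insertion_sum x u phi)
    - insertion_sum s u (fun y => insertion_sum t y phi)
  = insertion_sum t u (fun x => insertion_sum x s phi)
    - insertion_sum u s (fun y => insertion_sum t y phi).
Proof.
(* Moving the subtracted terms across leaves only sums, which can be compared by reordering. *)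
suff E : insertion_sum t s (fun x => insertion_sum x u phi)
    + insertion_sum u s (fun y => insertion_sum t y phi)
  = insertion_sum t u (fun x => insertion_sum x s phi)
    + insertion_sum s u (fun y => insertion_sum t y phi).
  by apply/eqP; rewrite subr_eq addrAC eq_sym subr_eq E.
(* [phi] is generalised because the hypotheses are applied to the test functions
   [fun x => phi (Node x r)] and [fun x => phi (Node l x)]. *)
elim: t phi => [a|l IHl r IHr] phi.
  rewrite !(insertion_sum_Leaf, insertion_sum_Node).
  under [insertion_sum u s (fun y => insertion_sum _ _ _)]eq_insertion_sum
    do rewrite insertion_sum_Leaf.
  under [insertion_sum s u (fun y => insertion_sum _ _ _)]eq_insertion_sum
    do rewrite insertion_sum_Leaf.
  by rewrite [RHS](AC (1*2*1) (2*(1*4)*3)).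
pose t := Node l r.
(* Half of the ways to insert [p] and [q] at independent places: [q] above the root with [p]
   anywhere in [t], or [p] in [l] and [q] in [r]. The other half is [sym q p]. *)
pose sym p q := phi (Node (Node t p) q)
  + (insertion_sum l p (fun x => phi (Node (Node x r) q))
     + insertion_sum r p (fun x => phi (Node (Node l x) q)))
  + insertion_sum l p (fun x => insertion_sum r q (fun y => phi (Node x y))).
(* Besides the independent placements, [q] may land inside [p] grafted at the root of [t], or both
   insertions may take place in the same child. *)
have nested p q : insertion_sum t p (fun x => insertion_sum x q phi)
    = (sym p q + sym q p) + insertion_sum p q (fun y => phi (Node t y))
      + (insertion_sum l p (fun x =>
           insertion_sum x q (fun y => phi (Node y r)))
         + insertion_sum r p (fun x =>
             insertion_sum x q (fun y => phi (Node l y)))).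
  rewrite !insertion_sum_Node.
  under [insertion_sum l p (fun x => insertion_sum _ _ _)]eq_insertion_sum
    do rewrite insertion_sum_Node.
  under [insertion_sum r p (fun x => insertion_sum _ _ _)]eq_insertion_sum
    do rewrite insertion_sum_Node.
  rewrite !insertion_sumD /sym.
  (* With [p] in [r] and [q] in [l], the order of summation must be that of the last term of
     [sym q p]. *)
  rewrite (exchange_insertion_sum r p l q).
  by rewrite [LHS](AC (1*(1*2*1)*((1*2)*(1*2)))
                      ((1*(6*9)*8)*(2*(3*4)*10)*5*(7*11))).
have inner p q : insertion_sum p q (fun y => insertion_sum t y phi)
    = insertion_sum p q (fun y => phi (Node t y))
      + (insertion_sum p q (fun y => insertion_sum l y (fun x => phi (Node x r)))
         + insertion_sum p q (fun y =>
             insertion_sum r y (fun x => phi (Node l x)))).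
  under eq_insertion_sum do rewrite insertion_sum_Node.
  by rewrite !insertion_sumD.
(* The terms in [phi (Node t y)] coming from [nested] on one side match those coming from [inner] on
   the other. What remains is the identity for [l] plus the one for [r]. *)
rewrite !nested !inner (addrC (sym u s)).
rewrite [LHS](AC (2*2*(1*2)) (1*(2*5)*((3*6)*(4*7)))).
rewrite [RHS](AC (2*2*(1*2)) (1*(5*2)*((3*6)*(4*7)))).
by congr (_ + (_ + _)); [exact: IHl | exact: IHr].
Qed.

End PlanarInsertion.

Section NonplanarInsertion.
Import GRing.Theory.

(** An isomorphism may swap the children of a node; then the sums over the two subtrees trade
    places, and [phi] does not see the order of children. This makes the sum well defined on
    isomorphism classes. *)
Lemma insertion_sum_iso (L : eqType) (M : nmodType) (t t' s s' : btree L)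
    (phi : btree L -> M) :
    {homo phi : x y / btree_iso x y >-> x = y} ->
    btree_iso t t' -> btree_iso s s' ->
  insertion_sum t s phi = insertion_sum t' s' phi.
Proof.
move=> + + iso_s; elim: t t' phi => [a|l IHl r IHr] [a'|l' r'] phi //= phiP.
  by move=> iso_t; rewrite !insertion_sum_Leaf; apply: phiP; rewrite /= iso_t iso_s.
move=> iso_t; rewrite !insertion_sum_Node.
congr (_ + _); first by apply: phiP; rewrite /= iso_t iso_s.
have phiNl c : {homo (fun x => phi (Node x c)) : x y / btree_iso x y >-> x = y}.
  by move=> x y xy; apply: phiP; rewrite /= xy btree_iso_refl.
have phiNr c : {homo (fun x => phi (Node c x)) : x y / btree_iso x y >-> x = y}.
  by move=> x y xy; apply: phiP; rewrite /= xy btree_iso_refl.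
case/orP: iso_t => /andP[iso_l iso_r].
  rewrite (IHl l') // (IHr r') //; congr (_ + _); apply: eq_insertion_sum => x.
    exact: phiNr.
  exact: phiNl.
rewrite (IHl r') // (IHr l') // addrC.
by congr (_ + _); apply: eq_insertion_sum => x; apply: phiP;
  rewrite /= ?iso_l ?iso_r btree_iso_refl orbT.
Qed.

Variables (L : choiceType) (k : fieldType).
Implicit Types (t s u : btree L) (x y z : {freeg (nbtree L) / k}).

Definition class t : nbtree L := \pi_(nbtree L)%qT t.
Definition tree_basis t : {freeg (nbtree L) / k} := << class t >>.

Lemma class_iso t s : btree_iso t s -> class t = class s.
Proof. by move=> h; apply/(@eqquotP _ _ (nbtree L)). Qed.

Lemma repr_class_iso t : btree_iso (repr (class t)) t.
Proof. by apply/(@eqquotP _ _ (nbtree L)); rewrite reprK. Qed.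

Lemma edge_insertion_basis_class t s :
  edge_insertion_basis k (class t) (class s) = insertion_sum t s tree_basis.
Proof.
rewrite -(insertion_sum_iso _ (repr_class_iso t) (repr_class_iso s)).
  rewrite /insertion_sum vertices_edges big_cons.
  (* The root vertex accounts for the grafting term; the case analysis lets [insert_at] reduce
     there. *)
  by congr (_ + _); rewrite /tree_basis /class /graft; case: (repr (class t)).
by move=> x y /class_iso; rewrite /tree_basis => ->.
Qed.

HB.instance Definition _ (K : choiceType) (M : lmodType k) (f : K -> M) :=
  GRing.isZmodMorphism.Build {freeg K / k} M (fglift f) (lift_is_additive f).

Lemma fglift_sum (K : choiceType) (M : lmodType k) (f : K -> M) D :
  fglift f D = \sum_(T <- dom D) coeff T D *: f T.
Proof.
by rewrite -[in LHS](freeg_sumE D) raddf_sum; apply: eq_bigr => T _; exact: liftU.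
Qed.

Lemma fglift_scalable (K : choiceType) (M : lmodType k) (f : K -> M) :
  scalable (fglift f).
Proof.
move=> c D; have -> : c *: D = \sum_(T <- dom D) << c * coeff T D *g T >> by [].
rewrite raddf_sum [in RHS]fglift_sum scaler_sumr /=.
by apply: eq_bigr => T _; rewrite liftU scalerA.
Qed.

HB.instance Definition _ (K : choiceType) (M : lmodType k) (f : K -> M) :=
  GRing.isScalable.Build k {freeg K / k} M *:%R (fglift f) (fglift_scalable f).

Lemma edge_insertionPl c x1 x2 y :
  (c *: x1 + x2) ◁ y = c *: (x1 ◁ y) + x2 ◁ y.
Proof. exact: linearP. Qed.

(** Here the varying argument sits inside the lifted function, so the outer lift is expanded;
    commutativity of [k] moves [c] past the coefficients of [x]. *)
Lemma edge_insertionPr c x y1 y2 :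
  x ◁ (c *: y1 + y2) = c *: (x ◁ y1) + x ◁ y2.
Proof.
rewrite /edge_insertion !fglift_sum scaler_sumr -big_split /=.
by apply: eq_bigr => T _; rewrite linearP scalerDr !scalerA mulrC.
Qed.

Lemma freeg_linear_ext (K : choiceType) (M : lmodType k)
    (f g : {freeg K / k} -> M) :
  linear f -> linear g -> (forall T, f << T >> = g << T >>) -> f =1 g.
Proof.
have lin0 (h : {freeg K / k} -> M) : linear h -> h 0 = 0.
  (* The scalar -1 makes the right-hand side [- h 0 + h 0]. *)
  by move=> lh; have := lh (-1) 0 0; rewrite scaler0 addr0 scaleN1r addNr.
move=> lf lg fg; elim/freeg_ind_dom0 => [|c T D _ _ IH]; first by rewrite !lin0.
have -> : << c *g T >> = c *: << T >> :> {freeg K / k}.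
  by apply/eqP/freeg_eqP => z; rewrite coeffZ !coeffU mul1r.
by rewrite lf lg fg IH.
Qed.

Lemma edge_insertion_suml t s (phi : btree L -> {freeg (nbtree L) / k}) y :
  insertion_sum t s phi ◁ y = insertion_sum t s (fun p => phi p ◁ y).
Proof. exact: raddf_sum. Qed.

Lemma edge_insertion_sumr t s (phi : btree L -> {freeg (nbtree L) / k}) x :
  x ◁ insertion_sum t s phi = insertion_sum t s (fun p => x ◁ phi p).
Proof.
apply: (big_morph (edge_insertion x)) => [y1 y2|].
  by have := edge_insertionPr 1 x y1 y2; rewrite !scale1r.
by have := edge_insertionPr (-1) x 0 0; rewrite scaler0 addr0 scaleN1r addNr.
Qed.

Lemma edge_insertion_tree_basis t s :
  tree_basis t ◁ tree_basis s = insertion_sum t s tree_basis.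
Proof. by rewrite /edge_insertion !liftU !scale1r edge_insertion_basis_class. Qed.

Definition associator x y z := (x ◁ y) ◁ z - x ◁ (y ◁ z).

Lemma associatorPl y z : linear (fun x => associator x y z).
Proof.
move=> c x1 x2; rewrite /associator !edge_insertionPl.
by rewrite scalerBr opprD addrACA.
Qed.

Lemma associatorPm x z : linear (fun y => associator x y z).
Proof.
move=> c y1 y2; rewrite /associator !(edge_insertionPl, edge_insertionPr).
by rewrite scalerBr opprD addrACA.
Qed.

Lemma associatorPr x y : linear (associator x y).
Proof.
move=> c z1 z2; rewrite /associator !edge_insertionPr.
by rewrite scalerBr opprD addrACA.
Qed.

(** This is the planar identity with [tree_basis] as test function. *)
Lemma associator_tree_basis t s u :
  associator (tree_basis t) (tree_basis s) (tree_basis u)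
    = associator (tree_basis t) (tree_basis u) (tree_basis s).
Proof.
have nested p q : (tree_basis t ◁ tree_basis p) ◁ tree_basis q
    = insertion_sum t p (fun t' => insertion_sum t' q tree_basis).
  rewrite edge_insertion_tree_basis edge_insertion_suml.
  exact/eq_insertion_sum/(edge_insertion_tree_basis ^~ q).
have inner p q : tree_basis t ◁ (tree_basis p ◁ tree_basis q)
    = insertion_sum p q (insertion_sum t ^~ tree_basis).
  rewrite edge_insertion_tree_basis edge_insertion_sumr.
  exact/eq_insertion_sum/(edge_insertion_tree_basis t).
by rewrite /associator !nested !inner insertion_sum_pre_lie.
Qed.

Lemma associatorC x y z : associator x y z = associator x z y.
Proof.
have basisE T : << T >> = tree_basis (repr T) :> {freeg (nbtree L) / k}.
  by rewrite /tree_basis /class reprK.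
move: x; apply: freeg_linear_ext; [exact: associatorPl..|move=> T].
(* [y] is in the middle slot on the left and in the last slot on the right; for [z] it is the
   reverse. *)
move: y; apply: freeg_linear_ext; [exact: associatorPm|exact: associatorPr|move=> S].
move: z; apply: freeg_linear_ext; [exact: associatorPr|exact: associatorPm|move=> U].
by rewrite !basisE associator_tree_basis.
Qed.

End NonplanarInsertion.

Theorem theorem3p1 (L : choiceType) (k : fieldType) (k_char0 : [pchar k] =i pred0)
    (x y z : {freeg (nbtree L) / k}) :
  (x ◁ y) ◁ z - x ◁ (y ◁ z) = (x ◁ z) ◁ y - x ◁ (z ◁ y).
Proof. exact: associatorC. Qed.
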